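(* Let $A \in \mathbb{R}^{m\times m}$, $b \in \mathbb{R}^m$, $V = \mathcal{C}(A,b)$ and $r = \operatorname{rank}(V)$. Suppose that the characteristic polynomial $$\det\bigl(sI - V_{(:,(1:r))}^\dagger A V_{(:,(1:r))}\bigr) = s^r + \alpha_{r-1}s^{r-1} + \dots + \alpha_1 s + \alpha_0$$ satisfies $\sum_{i=0}^{r-1} |\alpha_i| < 1$. Then $$\|V_{(:,(1:r))}^\dagger V_{(:,\{i^\ast\})}\|_{\ell_1} < 1 \quad \text{for all } i^\ast > r.$$ Consequently, for every $N$ and every $y\in\mathbb{R}^m$, a vector $u^\ast \in \mathbb{R}^N$ is not a solution of the problem: minimize $\|u\|_{\ell_1}$ over $u \in \mathbb{R}^N$ subject to $\mathcal{C}^N(A,b)u = y$, if there exists an $i^\ast \in \{r+1,\dots,N\}$ with $u^\ast_{i^\ast} \neq 0$.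
   Context: For $A\in\mathbb{R}^{m\times m}$, $b\in\mathbb{R}^m$ and $N \ge 1$, the extended controllability matrix is $\mathcal{C}^N(A,b) = [\, b \;\; Ab \;\; A^2b \;\; \cdots \;\; A^{N-1}b \,] \in \mathbb{R}^{m\times N}$; $\mathcal{C}(A,b) = [\, b \;\; Ab \;\; A^2 b\;\; \cdots\,]$ is its version with countably infinitely many columns ($N=\infty$). $V_{(:,(1:r))}$ denotes the submatrix of the first $r$ columns of $V$ and $V_{(:,\{i\})}$ the $i$-th column (so here $V_{(:,\{i\})} = A^{i-1}b$). $X^\dagger$ is the Moore–Penrose inverse of $X$, and $\|x\|_{\ell_1} = \sum_i |x_i|$. A solution of a minimization problem means a feasible global minimizer. *)

(* Defs.v *)
From HB Require Import structures.
From mathcomp Require Import all_boot all_order all_algebra.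
From mathcomp Require Import boolp classical_sets reals.

Set Implicit Arguments.
Unset Strict Implicit.
Unset Printing Implicit Defensive.

Import Order.TTheory GRing.Theory Num.Theory.

Local Open Scope ring_scope.

(* A matrix with m rows and countably many columns is the sequence
   V : nat -> 'cV[R]_m of its columns. Columns are numbered from 0, so the
   i-th column in the usual numbering from 1 is V i.-1. Likewise i : 'I_n
   stands for the coordinate of index i + 1, so that the range r+1, ..., n
   becomes r <= i. *)

Definition ctrb (R : realType) (m : nat) (A : 'M[R]_m) (b : 'cV[R]_m) :
  nat -> 'cV[R]_m := fun k => A ^+ k *m b.

Definition ext_ctrb (R : realType) (m : nat) (A : 'M[R]_m) (b : 'cV[R]_m)
  (N : nat) : 'M[R]_(m, N) := \matrix_(i < m, j < N) (A ^+ j *m b) i 0.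

(* The finite matrix of the columns of V selected by f. *)
Definition pick_cols (R : realType) (m : nat) (V : nat -> 'cV[R]_m)
  (k : nat) (f : 'I_k -> nat) : 'M[R]_(m, k) :=
  \matrix_(i < m, j < k) V (f j) i 0.

Definition first_cols (R : realType) (m : nat) (V : nat -> 'cV[R]_m)
  (r : nat) : 'M[R]_(m, r) := pick_cols V (@nat_of_ord r).

Definition indep_cols (R : realType) (m : nat) (V : nat -> 'cV[R]_m)
  (k : nat) (f : 'I_k -> nat) : Prop := \rank (pick_cols V f) = k.

(* The rank is the maximal number of linearly independent columns; the bound
   k <= m costs nothing, see inf_rank_max. *)
Definition inf_rank (R : realType) (m : nat) (V : nat -> 'cV[R]_m) : nat :=
  \max_(k < m.+1 | `[< exists f : 'I_k -> nat, indep_cols V f >]) k.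

Lemma inf_rank_max (R : realType) (m : nat) (V : nat -> 'cV[R]_m)
  (k : nat) (f : 'I_k -> nat) : indep_cols V f -> (k <= inf_rank V)%N.
Proof.
move=> fV; have km : (k < m.+1)%N by rewrite ltnS -fV rank_leq_row.
pose P := fun k : 'I_m.+1 => `[< exists f : 'I_k -> nat, indep_cols V f >].
apply: (@leq_bigmax_cond _ P (@nat_of_ord m.+1) (Ordinal km)).
by apply/asboolP; exists f.
Qed.

Lemma inf_rank_attained (R : realType) (m : nat) (V : nat -> 'cV[R]_m) :
  exists f : 'I_(inf_rank V) -> nat, indep_cols V f.
Proof.
rewrite /inf_rank.
set P := fun k : 'I_m.+1 => `[< exists f : 'I_k -> nat, indep_cols V f >].
have P0 : P ord0.
  apply/asboolP; exists (fun=> 0%N); rewrite /indep_cols.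
  by apply/eqP; rewrite -leqn0 rank_leq_col.
have cardP : (0 < #|P|)%N by apply/card_gt0P; exists ord0.
have [k Pk ->] := @eq_bigmax_cond _ P (@nat_of_ord m.+1) cardP.
exact: (asboolW Pk).
Qed.

(* The four Penrose equations. *)
Definition is_mpinv (R : realType) (m n : nat) (X : 'M[R]_(m, n))
  (Y : 'M[R]_(n, m)) : Prop :=
  [/\ X *m Y *m X = X, Y *m X *m Y = Y,
      (X *m Y)^T = X *m Y & (Y *m X)^T = Y *m X].

(* The Moore-Penrose inverse; unlike the library's pinvmx it is canonical, see
   mpinvP and is_mpinv_uniq. *)
Definition mpinv (R : realType) (m n : nat) (X : 'M[R]_(m, n)) :
  'M[R]_(n, m) := xget 0 [set Y | is_mpinv X Y]%classic.

Lemma is_mpinv_uniq (R : realType) (m n : nat) (X : 'M[R]_(m, n))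
  (Y Z : 'M[R]_(n, m)) : is_mpinv X Y -> is_mpinv X Z -> Y = Z.
Proof.
move=> [XYX YXY sXY sYX] [XZX ZXZ sXZ sZX].
have eXY : X *m Y = X *m Z.
  by rewrite -sXY -{1}XZX -mulmxA trmx_mul sXY sXZ mulmxA XYX.
have eYX : Y *m X = Z *m X.
  by rewrite -sYX -{1}XZX -mulmxA mulmxA trmx_mul sYX sZX -mulmxA (mulmxA X) XYX.
by rewrite -YXY eYX -mulmxA eXY mulmxA ZXZ.
Qed.

Lemma gram_unit (R : realType) (k n : nat) (B : 'M[R]_(k, n)) :
  row_free B -> B *m B^T \in unitmx.
Proof.
move=> fB; rewrite -row_free_unit -kermx_eq0; apply/eqP/row_matrixP => i.
set v := row i _; have vBB : v *m (B *m B^T) = 0.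
  by apply/sub_kermxP; exact: row_sub.
rewrite row0; apply: (row_free_inj fB); rewrite mul0mx.
have /matrixP/(_ 0 0) : (v *m B) *m (v *m B)^T = 0.
  by rewrite trmx_mul mulmxA -(mulmxA v) vBB mul0mx.
rewrite !mxE => /eqP; rewrite psumr_eq0; last first.
  by move=> j _; rewrite [(_^T) _ _]mxE -expr2 sqr_ge0.
move=> /allP h; apply/rowP => j; move: (h j (mem_index_enum j)).
by rewrite [(_^T) _ _]mxE -expr2 sqrf_eq0 => /eqP ->; rewrite mxE.
Qed.

Lemma mpinvP (R : realType) (m n : nat) (X : 'M[R]_(m, n)) :
  is_mpinv X (mpinv X).
Proof.
suff [Y XY] : exists Y, is_mpinv X Y by exact: (xgetI 0 XY).
set G := col_base X; set F := row_base X.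
have GF : G *m F = X by exact: mulmx_base.
have uF : F *m F^T \in unitmx by apply: gram_unit; exact: row_base_free.
have uG : G^T *m G \in unitmx.
  have := @gram_unit _ _ _ G^T; rewrite trmxK; apply.
  by rewrite /row_free mxrank_tr; exact: col_base_full.
pose iF := invmx (F *m F^T); pose iG := invmx (G^T *m G).
have siF : iF^T = iF by rewrite trmx_inv trmx_mul trmxK.
have siG : iG^T = iG by rewrite trmx_inv trmx_mul trmxK.
move: (\rank X) G F GF uF uG @iF @iG siF siG => k G F GF uF uG iF iG siF siG.
pose Y := F^T *m iF *m (iG *m G^T).
have XY : X *m Y = G *m iG *m G^T.
  by rewrite -GF /Y !mulmxA -(mulmxA G F) -(mulmxA G _ iF) mulmxV ?mulmx1.
have YX : Y *m X = F^T *m iF *m F.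
  rewrite -GF /Y !mulmxA -(mulmxA _ G^T G) -(mulmxA _ iG (G^T *m G)).
  by rewrite mulVmx ?mulmx1.
exists Y; split.
- by rewrite XY -GF !mulmxA -(mulmxA _ G^T G) -(mulmxA G iG) mulVmx ?mulmx1.
- rewrite YX /Y !mulmxA -(mulmxA _ F F^T) -(mulmxA _ (F *m F^T)) mulmxV //.
  by rewrite mulmx1.
- by rewrite XY !trmx_mul trmxK siG mulmxA.
- by rewrite YX !trmx_mul trmxK siF mulmxA.
Qed.

Definition l1norm (R : realType) (n : nat) (x : 'cV[R]_n) : R :=
  \sum_(i < n) `|x i 0|.

Definition is_l1_solution (R : realType) (m n : nat) (C : 'M[R]_(m, n))
  (y : 'cV[R]_m) (u : 'cV[R]_n) : Prop :=
  C *m u = y /\ forall w : 'cV[R]_n, C *m w = y -> l1norm u <= l1norm w.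

(* Main.v *)
Require Import Defs.
From HB Require Import structures.
From mathcomp Require Import all_boot all_order all_algebra.
From mathcomp Require Import boolp classical_sets reals.

(** Put [r := rank V] and [x k := mpinv Vr *m V k]. A column [A ^+ k *m b] that
   depends on the preceding ones spans, with them, an [A]-invariant subspace;
   hence the first [r] columns are independent and span all the columns, i.e.
   [V k = Vr *m x k]. Then [x k.+1 = M *m x k] with
   [M := mpinv Vr *m A *m Vr], and Cayley-Hamilton turns this into the
   recurrence [x (k + r) = - \sum_(i < r) alpha_i *: x (k + i)]. Since [x k] is a
   unit vector for [k < r], strong induction gives [l1norm (x k) <= 1] for
   all [k], and one more use of the recurrence makes it [< 1] for [r <= k].
   A feasible [u] with [u_i != 0] and [r <= i] is therefore improved by
   replacing [u_i *: V i] with [Vr *m (u_i *: x i)]. *)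

Set Implicit Arguments.
Unset Strict Implicit.
Unset Printing Implicit Defensive.

Import Order.TTheory GRing.Theory Num.Theory.

Local Open Scope ring_scope.

Section L1norm.
Variables (R : realType) (n : nat).
Implicit Types x y : 'cV[R]_n.

Lemma l1norm0 : l1norm (0 : 'cV[R]_n) = 0.
Proof. by rewrite /l1norm big1 // => i _; rewrite mxE normr0. Qed.

Lemma l1normD x y : l1norm (x + y) <= l1norm x + l1norm y.
Proof.
by rewrite -big_split; apply: ler_sum => i _; rewrite mxE ler_normD.
Qed.

Lemma l1normZ a x : l1norm (a *: x) = `|a| * l1norm x.
Proof. by rewrite mulr_sumr; apply: eq_bigr => i _; rewrite mxE normrM. Qed.

Lemma l1normN x : l1norm (- x) = l1norm x.
Proof. by apply: eq_bigr => i _; rewrite mxE normrN. Qed.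

Lemma l1norm_sum (I : finType) (F : I -> 'cV[R]_n) :
  l1norm (\sum_i F i) <= \sum_i l1norm (F i).
Proof.
apply: (big_ind2 (fun x s => l1norm x <= s)) => [|x s y t xs yt|//].
  by rewrite l1norm0.
exact: le_trans (l1normD x y) (lerD xs yt).
Qed.

Lemma l1norm_delta (i : 'I_n) : l1norm (delta_mx i 0 : 'cV[R]_n) = 1.
Proof.
rewrite /l1norm (bigD1 i) //= big1 ?addr0 => [|j /negPf ji].
  by rewrite mxE !eqxx normr1.
by rewrite mxE ji normr0.
Qed.

Lemma l1norm_remove x (i : 'I_n) :
  l1norm (x - x i 0 *: delta_mx i 0) = l1norm x - `|x i 0|.
Proof.
rewrite /l1norm (bigD1 i) // (bigD1 i (F := fun i => `|x i 0|)) //= addrAC.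
rewrite !mxE !eqxx mulr1 !subrr normr0; congr (_ + _).
by apply: eq_bigr => j /negPf ji; rewrite !mxE ji mulr0 subr0.
Qed.

End L1norm.

(** Each basis vector goes to a basis vector, or to 0 when its index is at least [n], so no
    coordinate gains weight. *)
Lemma l1norm_pid (R : realType) (n r : nat) (x : 'cV[R]_r) :
  l1norm (pid_mx r *m x : 'cV[R]_n) <= l1norm x.
Proof.
have xE : x = \sum_j x j 0 *: delta_mx j 0.
  rewrite {1}(matrix_sum_delta x); apply: eq_bigr => j _.
  by rewrite big_ord1.
rewrite {1}xE mulmx_sumr; apply: le_trans (l1norm_sum _) _.
apply: ler_sum => j _; rewrite -scalemxAr l1normZ ler_piMr // -colE.
have [jn|nj] := ltnP j n.
  suff -> : col j (pid_mx r) = delta_mx (Ordinal jn) 0 :> 'cV[R]_n.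
    by rewrite l1norm_delta.
  by apply/colP => i; rewrite !mxE -val_eqE andbT /=; case: eqP => // ->;
    rewrite ltn_ord.
suff -> : col j (pid_mx r) = 0 :> 'cV[R]_n by rewrite l1norm0.
apply/colP => i; rewrite !mxE; case: eqP => // ij.
by have := ltn_ord i; rewrite ij ltnNge nj.
Qed.

(** Full column rank allows cancelling [X] on the left of the Penrose equation [X *m Y *m X = X];
    the transposes turn this into cancelling a [row_free] matrix on the right. *)
Lemma mpinv_full_col (R : realType) (m n : nat) (X : 'M[R]_(m, n)) :
  \rank X = n -> mpinv X *m X = 1%:M.
Proof.
move=> rX; have [XYX _ _ _] := mpinvP X.
have fX : row_free X^T by rewrite /row_free mxrank_tr rX.
apply: trmx_inj; apply: (row_free_inj fX).
by rewrite -trmx_mul mulmxA XYX -trmx_mul mulmx1.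
Qed.

Section Columns.
Variables (R : realType) (m : nat) (V : nat -> 'cV[R]_m).

(** Since [<=] on matrices compares row spaces, spans of columns are handled through transposes from
    here on. *)
Lemma tr_pick_sub k (f : 'I_k -> nat) p (B : 'M[R]_(p, m)) :
  (forall i, (V (f i))^T <= B)%MS -> ((pick_cols V f)^T <= B)%MS.
Proof.
move=> VB; apply/row_subP => i; suff -> : row i (pick_cols V f)^T = (V (f i))^T.
  exact: VB.
by apply/rowP => j; rewrite !mxE.
Qed.

Lemma first_cols_delta k (i : 'I_k) : first_cols V k *m delta_mx i 0 = V i.
Proof. by rewrite -colE; apply/colP => j; rewrite !mxE. Qed.

Lemma tr_first_cols_sub i k : (i < k)%N -> ((V i)^T <= (first_cols V k)^T)%MS.
Proof.
by move=> ik; rewrite -(first_cols_delta (Ordinal ik)) trmx_mul submxMl.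
Qed.

Lemma rank_first_colsS k : ~~ ((V k)^T <= (first_cols V k)^T)%MS ->
  (\rank (first_cols V k) < \rank (first_cols V k.+1))%N.
Proof.
move=> Vk; rewrite -[X in (X < _)%N]mxrank_tr -[X in (_ < X)%N]mxrank_tr.
apply: rank_ltmx; rewrite ltmxE; apply/andP; split.
  by apply: tr_pick_sub => i; apply: tr_first_cols_sub; rewrite ltnW ?ltnS.
by apply: contra Vk; apply: submx_trans; apply: tr_first_cols_sub.
Qed.

Lemma first_cols_free k :
  (forall j, (j < k)%N -> ~~ ((V j)^T <= (first_cols V j)^T)%MS) ->
  \rank (first_cols V k) = k.
Proof.
elim: k => [|k IHk] Vk; apply/eqP; rewrite eqn_leq rank_leq_col //.
apply: leq_ltn_trans (rank_first_colsS (Vk k (ltnSn k))).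
by rewrite IHk // => j jk; apply: Vk; rewrite ltnW.
Qed.

End Columns.

Section Controllability.
Variables (R : realType) (m : nat) (A : 'M[R]_m) (b : 'cV[R]_m).
Local Notation V := (ctrb A b).
Local Notation r := (inf_rank V).
Local Notation Vr := (first_cols V r).

Lemma ctrbS k : V k.+1 = A *m V k.
Proof. by rewrite /ctrb mulmxA exprS. Qed.

Lemma ctrb_stationary j : ((V j)^T <= (first_cols V j)^T)%MS ->
  forall i, ((V i)^T <= (first_cols V j)^T)%MS.
Proof.
move=> Vj; have Aj : ((first_cols V j)^T *m A^T <= (first_cols V j)^T)%MS.
  rewrite -trmx_mul; apply/row_subP => i.
  suff -> : row i (A *m first_cols V j)^T = (V i.+1)^T.
    (* [A] shifts the columns by one: only the last of them leaves the first [j], and it lands on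
       [V j], covered by [Vj]. *)
    have := ltn_ord i; rewrite leq_eqVlt => /predU1P[->//|].
    exact: tr_first_cols_sub.
  by rewrite -tr_col colE -mulmxA first_cols_delta ctrbS.
elim=> [|i IHi]; last first.
  by rewrite ctrbS trmx_mul; apply: submx_trans Aj; apply: submxMr.
(* For [j = 0] there is no preceding column, and the claim about [V 0] is the hypothesis itself. *)
by case: (posnP j) Vj => [->//|j0 _]; apply: tr_first_cols_sub.
Qed.

(** A dependent column [j < r] would confine all columns to a space of dimension at most [j], yet
    some [r] of them are independent. *)
Lemma rank_first_ctrb : \rank Vr = r.
Proof.
apply: first_cols_free => j jr; apply/negP => /ctrb_stationary Vj.
have [f fV] := inf_rank_attained V.
have := mxrankS (tr_pick_sub (fun i => Vj (f i))).
rewrite !mxrank_tr fV => /leq_trans/(_ (rank_leq_col _)).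
by rewrite leqNgt jr.
Qed.

(** If column [r] were outside the span of the first [r], the first [r.+1] columns would be
    independent, against the maximality of [r]. *)
Lemma ctrb_sub_first i : ((V i)^T <= Vr^T)%MS.
Proof.
apply: ctrb_stationary; apply/negPn/negP => /rank_first_colsS.
rewrite rank_first_ctrb => rV.
suff /inf_rank_max : indep_cols V (@nat_of_ord r.+1) by rewrite ltnn.
by apply/eqP; rewrite eqn_leq rank_leq_col.
Qed.

Local Notation x k := (mpinv Vr *m V k).
Local Notation M := (mpinv Vr *m A *m Vr).

Lemma ctrb_coordK k : Vr *m x k = V k.
Proof.
have [XYX _ _ _] := mpinvP Vr; have /submxP[D VD] := ctrb_sub_first k.
have -> : V k = Vr *m D^T by apply: trmx_inj; rewrite VD trmx_mul trmxK.
by rewrite !mulmxA XYX.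
Qed.

Lemma ctrb_coord_delta (i : 'I_r) : x i = delta_mx i 0.
Proof.
by rewrite -(first_cols_delta V) mulmxA (mpinv_full_col rank_first_ctrb) mul1mx.
Qed.

Lemma ctrb_coordX k i : x (i + k)%N = M ^+ i *m x k.
Proof.
elim: i => [|i IHi]; first by rewrite expr0 mul1mx.
by rewrite addSn exprS -[RHS]mulmxA -IHi ctrbS -[V (i + k)%N in LHS]ctrb_coordK
  !mulmxA.
Qed.

Lemma ctrb_coord_rec k :
  x (r + k)%N = - \sum_(i < r) (char_poly M)`_i *: x (i + k)%N.
Proof.
apply/eqP; rewrite -addr_eq0; apply/eqP.
have sP := size_char_poly M; have lP : (char_poly M)`_r = 1.
  by have := char_poly_monic M; rewrite monicE lead_coefE sP => /eqP.
have MP : \sum_(i < r.+1) (char_poly M)`_i *: M ^+ i = 0.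
  (* The case [r = 0] is an equality of empty matrices; [Cayley_Hamilton] is applied in size
     [n.+1]. *)
  move: sP; move: M; case: (r) => [|n] B sP; first by apply/matrixP => [[]].
  have := Cayley_Hamilton B; rewrite /horner_mx /horner_morph.
  rewrite horner_coef size_map_poly sP => CH; rewrite -[RHS]CH.
  by apply: eq_bigr => i _; rewrite coef_map /= -mul_scalar_mx.
have := congr1 (fun B => B *m x k) MP; rewrite mul0mx mulmx_suml.
rewrite big_ord_recr /= lP scale1r -ctrb_coordX addrC => {2}<-.
by congr (_ + _); apply: eq_bigr => i _; rewrite -scalemxAl -ctrb_coordX.
Qed.

Hypothesis alpha_lt1 : \sum_(i < r) `|(char_poly M)`_i| < 1.

(** Keeping the sum as the bound, instead of 1, lets the same estimate serve both the induction and
    the final strict inequality. *)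
Lemma ctrb_coord_le_alpha k : (forall i, (i < r + k)%N -> l1norm (x i) <= 1) ->
  l1norm (x (r + k)%N) <= \sum_(i < r) `|(char_poly M)`_i|.
Proof.
move=> xle1; rewrite ctrb_coord_rec l1normN; apply: le_trans (l1norm_sum _) _.
apply: ler_sum => i _; rewrite l1normZ ler_piMr //.
by apply: xle1; rewrite ltn_add2r.
Qed.

Lemma ctrb_coord_le1 k : l1norm (x k) <= 1.
Proof.
elim/ltn_ind: k => k IHk; have [kr|rk] := ltnP k r.
  by rewrite (ctrb_coord_delta (Ordinal kr)) l1norm_delta.
rewrite -(subnKC rk); apply: le_trans (ltW alpha_lt1).
by apply: ctrb_coord_le_alpha => i; rewrite subnKC //; apply: IHk.
Qed.

Lemma ctrb_coord_lt1 k : (r <= k)%N -> l1norm (x k) < 1.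
Proof.
move=> rk; rewrite -(subnKC rk); apply: le_lt_trans alpha_lt1.
by apply: ctrb_coord_le_alpha => i _; apply: ctrb_coord_le1.
Qed.

Lemma ext_ctrb_delta N (i : 'I_N) : ext_ctrb A b N *m delta_mx i 0 = V i.
Proof. by rewrite -colE; apply/colP => j; rewrite !mxE. Qed.

Lemma ext_ctrb_pid N k : (k <= N)%N ->
  ext_ctrb A b N *m pid_mx k = first_cols V k.
Proof.
move=> kN; apply/matrixP => i j; have jN := leq_trans (ltn_ord j) kN.
rewrite mxE (bigD1 (Ordinal jN)) //= big1 ?addr0 => [|l].
  by rewrite !mxE /= eqxx ltn_ord mulr1.
by rewrite -val_eqE !mxE /= => /negPf->; rewrite mulr0.
Qed.

Lemma not_l1_solution N (y : 'cV[R]_m) (u : 'cV[R]_N) (i : 'I_N) :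
  (r <= i)%N -> u i 0 != 0 -> ~ is_l1_solution (ext_ctrb A b N) y u.
Proof.
move=> ri ui [Cu umin]; pose P : 'M[R]_(N, r) := pid_mx r.
(* [P] pads [x i] with zeros up to length [N], which is possible because [r <= i < N]. *)
pose w := u - u i 0 *: delta_mx i 0 + u i 0 *: (P *m x i).
have Cw : ext_ctrb A b N *m w = y.
  rewrite mulmxDr mulmxBr Cu -!scalemxAr ext_ctrb_delta [_ *m (P *m _)]mulmxA.
  rewrite ext_ctrb_pid ?ctrb_coordK ?subrK //.
  exact: leq_trans ri (ltnW (ltn_ord i)).
have := umin w Cw; apply/negP; rewrite -ltNge.
apply: le_lt_trans (l1normD _ _) _; rewrite l1norm_remove l1normZ -addrA.
(* Removing entry [i] saves the absolute value of [u i 0]; adding the new term costs at most that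
   value times a factor below 1. *)
rewrite -[ltRHS]addr0 ltrD2l addrC subr_lt0 gtr_pMr ?normr_gt0 //.
exact: le_lt_trans (l1norm_pid _ _) (ctrb_coord_lt1 ri).
Qed.

End Controllability.

Theorem theorem2 (R : realType) (m : nat) (A : 'M[R]_m) (b : 'cV[R]_m)
  (V : nat -> 'cV[R]_m) (hV : V = ctrb A b)
  (r : nat) (hr : r = inf_rank V)
  (Vr : 'M[R]_(m, r)) (hVr : Vr = first_cols V r)
  (halpha : \sum_(i < r) `|(char_poly (mpinv Vr *m A *m Vr))`_i| < 1) :
  (forall i : nat, (r < i)%N -> l1norm (mpinv Vr *m V i.-1) < 1) /\
  (forall (N : nat) (hN : (1 <= N)%N) (y : 'cV[R]_m) (u : 'cV[R]_N),
     (exists i : 'I_N, (r <= i)%N /\ u i 0 != 0) ->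
     ~ is_l1_solution (ext_ctrb A b N) y u).
Proof.
subst Vr r V; split=> [i ri|N _ y u [i [ri ui]]].
  (* Here [i] counts columns from 1, so [r < i] becomes [r <= i.-1]. *)
  by apply: ctrb_coord_lt1 => //; rewrite -ltnS (ltn_predK ri).
exact: (not_l1_solution halpha ri ui).
Qed.
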